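(* Let $p$ be a prime and let $G$ be a finite $p$-group. Let $p^k$ be the maximal order of a subgroup of $G$ of nilpotency class at most $2$ and exponent dividing $p$ if $p$ is odd, respectively of nilpotency class at most $2$ and exponent dividing $8$ if $p = 2$. Then $G$ can be generated by $k$ elements, i.e. $d(G) \leq k$.
   Context: $d(G)$ denotes the minimal number of generators of $G$. *)

(* Defs.v *)
From mathcomp Require Export all_boot all_fingroup all_solvable.

(* Main.v *)
Require Import Defs.

Set Implicit Arguments.
Unset Strict Implicit.
Unset Printing Implicit Defensive.

Local Open Scope group_scope.

(** The proof replaces the number of generators by the index of a larger
    verbal quotient that is just big enough to treat all primes alike.  For
    a p-group H write F(H) = H' H^q, with q = p for p odd and q = 4 for
    p = 2, so that H / F(H) is the largest abelian quotient of exponent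
    dividing q; in both cases p divides q (q - 1) / 2.  As F(H) lies in the
    Frattini subgroup, Burnside's basis theorem gives p ^ d(G) <= |G : F(G)|.

    Let H be a subgroup of G of least order among those with
    |H : F(H)| >= |G : F(G)|.  Then F(H) is central in H, so that H has class
    at most 2.  Otherwise some normal subgroup M of H has index p in
    [F(H), H]; working modulo M, where [F(H), H] has order p and therefore is
    central, the centraliser C of F(H) is a proper subgroup such that
    - F(C) is central in H: for c in C and g in H, the commutators [c, g ^ q],
      which is trivial, and [c ^ q, g] are both equal to [c, g] ^ q, because
      the term in [c, g, g] ^ (q (q - 1) / 2) that appears in the expansion
      of the former is trivial;
    - |H : C| <= |F(H) : F(H) :&: Z(H)|, because commutation is a pairing of
      F(H) with H whose values lie in a group of order p.
    The two together give |C : F(C)| >= |H : F(H)|, against the choice of H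
    ([index_derMho_le_cent], [smaller_subgroup_of_derMho_not_central]).

    Finally, let n = p for p odd and n = 8 for p = 2.  In H, the commutators
    are central of order dividing q, and q divides both n and n (n - 1) / 2;
    thus x |-> x ^ n is an endomorphism of H with image inside F(H), and its
    kernel K, of class at most 2 and exponent dividing n, has order at least
    |H : F(H)| >= |G : F(G)| >= p ^ d(G). *)

Section DerMho.

Variable gT : finGroupType.
Implicit Types (p e : nat) (G A : {group gT}).

Definition derMho e G : {group gT} := (G^`(1) <*> 'Mho^e(G))%G.

Lemma derMho_sub e G : derMho e G \subset G.
Proof. by rewrite join_subG der_sub Mho_sub. Qed.

Lemma derMho_normal e G : derMho e G <| G.
Proof. by rewrite /= normalY // gFnormal. Qed.

Lemma derg1_sub_derMho e G : G^`(1) \subset derMho e G.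
Proof. exact: joing_subl. Qed.

Lemma derMho_expg p e G x : p.-group G -> x \in G -> x ^+ (p ^ e) \in derMho e G.
Proof.
move=> pG Gx; apply: (subsetP (joing_subr _ _)).
by rewrite Mho_p_elt // (mem_p_elt pG).
Qed.

Lemma derMho_subset p e G A : p.-group G -> G^`(1) \subset A ->
  {in G, forall x, x ^+ (p ^ e) \in A} -> derMho e G \subset A.
Proof.
move=> pG sG'A GqA; rewrite join_subG sG'A (MhoE e pG) gen_subG.
by apply/subsetP=> _ /imsetP[x Gx ->]; apply: GqA.
Qed.

End DerMho.

Lemma quotient_derMho (gT : finGroupType) (e : nat) (G M : {group gT}) :
  G \subset 'N(M) -> derMho e G / M = derMho e (G / M)%G.
Proof.
move=> nMG; rewrite /= quotientY ?gFsub_trans //.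
by rewrite quotient_der // /quotient morphim_Mho.
Qed.

(** Climb from 'C_A(G) to A through a chain of subgroups, each maximal in the
    next.  Every step adjoins an element x of A; the order is multiplied by p,
    while the centraliser in G shrinks by a factor at most
    |x ^: G| <= |[A, G]| <= p. *)
Lemma index_cent_le_index_subcent (gT : finGroupType) (p : nat)
    (A G : {group gT}) :
  p.-group A -> #|[~: A, G]| <= p ->
  #|G : 'C_G(A)| <= #|A : 'C_A(G)|.
Proof.
have [m] := ubnP #|A|; elim: m A => // m IHm A ltAm pA leRp.
have [cAG|] := maximal_exists (subsetIl A 'C(G)).
  rewrite cAG (setIidPl _) ?indexgg // centsC -{1}cAG; exact: subsetIr.
case=> B maxB sZB; have [ltBA _] := maxgroupP maxB.
have [sBA [x Ax B'x]] := properP ltBA.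
have defA: B * <[x]> = A.
  by apply: mulg_normal_maximal (p_maximal_normal pA maxB) maxB _ _;
     rewrite cycle_subG.
have cAE: 'C_G(A) = 'C_('C_G(B))[x] by rewrite -defA centM cent_cycle setIA.
have cBE: 'C_B(G) = 'C_A(G).
  by apply/eqP; rewrite eqEsubset setSI //= subsetI sZB subsetIr.
rewrite -(Lagrange_index (subsetIl G _) (setIS _ (centS sBA))).
rewrite -(Lagrange_index sBA sZB) mulnC leq_mul //.
  rewrite /= cAE index_cent1 (p_maximal_index pA maxB); apply: leq_trans leRp.
  rewrite -(card_lcoset [~: A, G] x) subset_leq_card //.
  apply/subsetP=> _ /imsetP[g /setIP[Gg _] ->].
  by rewrite conjg_mulR mem_lcoset mulKg mem_commg.
rewrite /= -cBE; apply: IHm (pgroupS sBA pA) _; last first.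
  by apply: leq_trans leRp; rewrite subset_leq_card ?commSg.
by apply: leq_trans (proper_card ltBA) _.
Qed.

(** As c fixes g ^ n = (g ^ c) ^ n = (g * [g, c]) ^ n, it is enough to expand
    the last power; the second-order term is an 'C(n, 2)-th power. *)
Lemma expg_commg_eq1 (gT : finGroupType) (n : nat) (c g : gT) :
  commute c (g ^+ n) -> commute [~ g, c] [~ [~ g, c], g] ->
  commute g [~ [~ g, c], g] -> [~ [~ g, c], g] ^+ 'C(n, 2) = 1 ->
  [~ g, c] ^+ n = 1.
Proof.
move=> cgn cz1 cz2 zn1.
have: (g ^+ n) ^ c = g ^+ n by apply/conjg_fixP/commgP/commute_sym.
rewrite conjXg conjg_mulR expMg_Rmul // zn1 mulg1 => /(canRL (mulKg _)).
by rewrite mulVg.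
Qed.

(** Write F = F(G) and C = 'C_G(F).  The indices |C : F| and |G : F| differ by
    the factor |G : C|, and |C : F(C)| exceeds |C : F| by |F : F(C)|.  As F(C)
    lies in 'C_F(G), the pairing of F with G into a group of order p makes the
    second factor at least as large as the first. *)
Lemma index_derMho_le_cent (gT : finGroupType) (p e : nat) (G : {group gT}) :
  prime p -> p.-group G -> 0 < e -> p %| 'C(p ^ e, 2) ->
  #|[~: derMho e G, G]| = p ->
  #|G : derMho e G|
    <= #|'C_G(derMho e G) : derMho e ('C_G(derMho e G))%G|.
Proof.
move=> p_pr pG e_gt0 pq oR; set F := derMho e G in oR *; set C := ('C_G(F))%G.
have sFG : F \subset G := derMho_sub e G.
have sG'F : G^`(1) \subset F := derg1_sub_derMho e G.
have nsRG : [~: F, G] <| G.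
  by rewrite /normal comm_subG // normsRr ?normG.
have sRZ : [~: F, G] \subset 'Z(G).
  have prR : prime #|[~: F, G]| by rewrite oR.
  rewrite (prime_meetG prR) // meet_center_nil ?(pgroup_nil pG) //.
  by rewrite -cardG_gt1 oR prime_gt1.
have cRG z g : z \in [~: F, G] -> g \in G -> commute z g.
  by move=> Rz Gg; apply: (centP (subsetP (subsetIr _ _) z (subsetP sRZ z Rz))).
have Rp z n : z \in [~: F, G] -> p %| n -> z ^+ n = 1.
  by move=> Rz /dvdnP[i ->]; rewrite mulnC expgM -{1}oR expg_cardG // expg1n.
have p_q : p %| p ^ e by rewrite dvdn_exp.
have cFGG : [~: F, G, G] = 1.
  by apply/commG1P; apply: subset_trans sRZ (subsetIr _ _).
(* Commutators centralise F by the three subgroup lemma, p ^ e-th powers because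
   [F, G] is central of exponent p. *)
have cFF : F \subset 'C(F).
  apply: subset_trans (subsetIr G _).
  apply: (derMho_subset pG) => [|g Gg].
    rewrite subsetI der_sub; apply/commG1P; apply: three_subgroup=> //.
    by rewrite [[~: G, F]]commGC.
  rewrite inE groupX //=; apply/centP=> x Fx; apply/commgP/eqP.
  have Rgx : [~ g, x] \in [~: F, G] by rewrite commGC mem_commg.
  by rewrite commXg ?Rp //; apply: commute_sym; apply: cRG.
have sFC : F \subset C by rewrite subsetI sFG.
have sCG : C \subset G := subsetIl _ _.
have cCF c x : c \in C -> x \in F -> commute c x.
  by move=> /setIP[_ /centP cFc] /cFc.
(* Unlike in F, a commutator [c, g] need not have order p here; its
   p ^ e-th power is reached through c commuting with g ^ (p ^ e), which lies
   in F. *)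
have sFCZ : derMho e C \subset 'C_F(G).
  apply: (derMho_subset (pgroupS sCG pG)) => [|c Cc].
    rewrite subsetI (subset_trans (dergS 1 sCG)) //; apply/commG1P.
    have cCGC : [~: C, G, C] = 1.
      apply/commG1P; apply: subset_trans (subset_trans (commSg G sCG) sG'F) _.
      by rewrite centsC subsetIr.
    by apply: three_subgroup=> //; rewrite [[~: G, C]]commGC.
  have Gc := subsetP sCG c Cc.
  rewrite inE derMho_expg //=; apply/centP=> g Gg; apply/commgP/eqP.
  have Fgc : [~ g, c] \in F by rewrite (subsetP sG'F) ?mem_commg.
  have Rgcg : [~ [~ g, c], g] \in [~: F, G] by rewrite mem_commg.
  have Fcg : [~ c, g] \in F by rewrite -invg_comm groupV.
  rewrite commXg; last exact: cCF.
  rewrite -invg_comm expVgn expg_commg_eq1 ?invg1 //.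
  - by apply: cCF; rewrite ?derMho_expg.
  - by apply: commute_sym; apply: cRG => //; apply: (subsetP sFG).
  - by apply: commute_sym; apply: cRG.
  by rewrite Rp.
have leGC : #|G : C| <= #|F : 'C_F(G)|.
  by apply: (@index_cent_le_index_subcent _ p); rewrite ?(pgroupS sFG) ?oR.
apply: leq_trans (dvdn_leq (indexg_gt0 _ _) (indexgS _ sFCZ)).
rewrite -(Lagrange_index sCG sFC) -(Lagrange_index sFC (subsetIl F 'C(G))).
by rewrite mulnC leq_mul2l leGC orbT.
Qed.

(** Passing to the quotient by a normal subgroup M of index p in [F(G), G]
    makes this commutator subgroup have order p.  As M lies in F(G) the index
    |G : F(G)| does not change, and the preimage H of the centraliser satisfies
    |H : F(H)| >= |H / M : F(H / M)|. *)
Lemma smaller_subgroup_of_derMho_not_central (gT : finGroupType) (p e : nat)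
    (G : {group gT}) :
  prime p -> p.-group G -> 0 < e -> p %| 'C(p ^ e, 2) ->
  ~~ (derMho e G \subset 'Z(G)) ->
  exists2 H : {group gT}, H \proper G & #|G : derMho e G| <= #|H : derMho e H|.
Proof.
move=> p_pr pG e_gt0 pq nsFZ; set F := derMho e G.
have sFG : F \subset G := derMho_sub e G.
have nFG : G \subset 'N(F) := normal_norm (derMho_normal e G).
have nsRG : [~: F, G] <| G.
  by rewrite /normal comm_subG // normsRr ?normG.
have pR : p.-group [~: F, G] := pgroupS (normal_sub nsRG) pG.
have R_gt1 : 0 < logn p #|[~: F, G]|.
  rewrite logn_gt0 mem_primes p_pr cardG_gt0 /=.
  have [|_ -> //] := pgroup_pdiv pR.
  by apply: contraNneq nsFZ => /commG1P cFG; rewrite subsetI sFG.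
have [M [sMR nsMG oM]] := normal_pgroup pG nsRG (leq_pred _).
have nMG := normal_norm nsMG.
have sMF : M \subset F by rewrite (subset_trans sMR) ?commg_subl.
have FqE : F / M = derMho e (G / M)%G by rewrite quotient_derMho.
have oRq : #|[~: derMho e (G / M)%G, (G / M)%G]| = p.
  rewrite -FqE -quotientR ?(subset_trans sFG) // card_quotient; last first.
    exact: subset_trans (normal_sub nsRG) nMG.
  rewrite -divgS //= oM {1}(card_pgroup pR) -expnB ?prime_gt0 ?leq_pred //.
  by rewrite -[X in (X - _)%N](prednK R_gt1) subSnn expn1.
have pGq : p.-group (G / M) := quotient_pgroup M pG.
pose Cq := ('C_(G / M)(derMho e (G / M)%G))%G.
have leGC : #|G / M : F / M| <= #|Cq : derMho e Cq|.
  by rewrite FqE; apply: index_derMho_le_cent p_pr pGq e_gt0 pq oRq.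
have ltCG : Cq \proper (G / M)%G.
  rewrite properE subsetIl; apply: contraL (prime_gt1 p_pr).
  move/subset_trans=> /(_ _ (subsetIr _ _)).
  by rewrite centsC => /commG1P cFG; rewrite -oRq cFG cards1.
have [H defC sMH sHG] := inv_quotientS nsMG (proper_sub ltCG).
have nMH := subset_trans sHG nMG.
have nsMH : M <| H by rewrite /normal sMH.
exists H; first by rewrite -(quotient_proper nsMH nsMG) /= -defC.
rewrite -(index_quotient_eq _ sFG nMG) ?(subset_trans (subsetIr _ _)) //.
apply: leq_trans leGC _; have -> : Cq = (H / M)%G by apply: val_inj.
rewrite -quotient_derMho //; apply: dvdn_leq => //.
by rewrite index_quotient // (subset_trans (subsetIl _ _)).
Qed.

Lemma exists_derMho_central (gT : finGroupType) (p e : nat) (G : {group gT}) :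
  prime p -> p.-group G -> 0 < e -> p %| 'C(p ^ e, 2) ->
  exists2 H : {group gT}, H \subset G
    & derMho e H \subset 'Z(H) /\ #|G : derMho e G| <= #|H : derMho e H|.
Proof.
move=> p_pr pG e_gt0 pq; have [m] := ubnP #|G|.
elim: m G pG => // m IHm G pG ltGm.
have [sFZ | nsFZ] := boolP (derMho e G \subset 'Z(G)); first by exists G.
have [H ltHG leGH] :=
  smaller_subgroup_of_derMho_not_central p_pr pG e_gt0 pq nsFZ.
have sHG := proper_sub ltHG.
have [|K sKH [sKZ leHK]] := IHm H (pgroupS sHG pG).
  exact: leq_trans (proper_card ltHG) _.
exists K; first exact: subset_trans sKH sHG.
by split=> //; apply: leq_trans leHK.
Qed.

(** When F(G) is central, [x, y] ^ (p ^ e) = [x ^ (p ^ e), y] = 1; hence the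
    n-th power map is an endomorphism, and its image lies in F(G).  The
    subgroup K is its kernel. *)
Lemma exists_large_class2_exponent (gT : finGroupType) (p e n : nat)
    (G : {group gT}) :
  p.-group G -> derMho e G \subset 'Z(G) -> p ^ e %| n -> p ^ e %| 'C(n, 2) ->
  exists2 K : {group gT}, K \subset G
    & [/\ nil_class K <= 2, exponent K %| n & #|G : derMho e G| <= #|K|].
Proof.
move=> pG sFZ qn qn2.
have sG'Z : G^`(1) \subset 'Z(G) := subset_trans (derg1_sub_derMho e G) sFZ.
have cFG z g : z \in derMho e G -> g \in G -> commute z g.
  by move=> Fz Gg; apply: (centP (subsetP (subsetIr _ _) z (subsetP sFZ z Fz))).
have FR x y : x \in G -> y \in G -> [~ x, y] \in derMho e G.
  by move=> Gx Gy; rewrite (subsetP (derg1_sub_derMho e G)) ?mem_commg.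
have expM : {in G &, {morph (fun x => x ^+ n) : x y / x * y}}.
  move=> x y Gx Gy /=; rewrite expMg_Rmul; last 2 first.
  - by apply: commute_sym; apply: cFG; rewrite ?FR.
  - by apply: commute_sym; apply: cFG; rewrite ?FR.
  case/dvdnP: qn2 => i ->; rewrite mulnC expgM -commXg; last first.
    by apply: commute_sym; apply: cFG; rewrite ?FR.
  have /commgP/eqP-> : commute (y ^+ (p ^ e)) x.
    by apply: cFG; rewrite ?derMho_expg.
  by rewrite expg1n mulg1.
pose f := Morphism expM; have sKG : 'ker f \subset G := subsetIl _ _.
exists ('ker f)%G => //; split.
- rewrite nil_class2 subsetI der_sub (subset_trans (dergS 1 sKG)) //.
  by apply: subset_trans sG'Z (subset_trans (subsetIr _ _) (centS sKG)).
- by apply/exponentP=> x Kx; apply: (mker Kx).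
have sfGF : f @* G \subset derMho e G.
  apply/subsetP=> _ /morphimP[x _ Gx ->] /=.
  by case/dvdnP: qn => i ->; rewrite mulnC expgM groupX ?derMho_expg.
have oG : (#|'ker f| * #|f @* G|)%N = #|G|.
  by rewrite card_morphim setIid Lagrange.
rewrite -(leq_pmul2l (cardG_gt0 (derMho e G))) Lagrange ?derMho_sub // -oG.
by rewrite mulnC leq_mul2r subset_leq_card ?orbT.
Qed.

(** Half of Burnside's basis theorem: lifts of a basis of G / 'Phi(G)
    generate G. *)
Lemma grank_le_logn_index_Phi (gT : finGroupType) (p : nat) (G : {group gT}) :
  p.-group G -> 'm(G) <= logn p #|G : 'Phi(G)|.
Proof.
move=> pG; have nPG : G \subset 'N('Phi(G)) := gFnorm _ _.
have abelGq := Phi_quotient_abelem pG; have [_ cGqGq _] := and3P abelGq.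
have [/= Xq defGq oXq] := grank_witness (G / 'Phi(G)).
pose X := (repr \o val : coset_of _ -> gT) @: Xq.
have oX : #|X| <= 'm(G / 'Phi(G)).
  by rewrite -oXq leq_imset_card.
rewrite -card_quotient // -(rank_abelem abelGq) -(grank_abelian cGqGq).
apply: leq_trans oX.
have sXG : X \subset G.
  apply/subsetP=> _ /imsetP[xq Xxq ->]; have nPx := repr_coset_norm xq.
  rewrite -sub1set -(quotientSGK _ (Phi_sub G)) ?sub1set ?quotient_set1 //=.
  by rewrite sub1set coset_reprK -defGq mem_gen.
have <- : <<X>> = G; last exact: grank_min.
apply: Phi_nongen; apply/eqP.
rewrite eqEsubset join_subG Phi_sub sXG -joing_idr.
rewrite -genM_join sub_gen // -quotientSK ?quotient_gen ?(subset_trans sXG) //.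
rewrite -defGq genS //; apply/subsetP=> xq Xxq; apply/imsetP.
rewrite (setIidPr (subset_trans sXG nPG)).
by exists (repr (val xq)); rewrite /= ?coset_reprK //; apply: imset_f.
Qed.

Lemma expn_grank_le_index_derMho (gT : finGroupType) (p e : nat)
    (G : {group gT}) :
  prime p -> p.-group G -> 0 < e -> p ^ 'm(G) <= #|G : derMho e G|.
Proof.
move=> p_pr pG e_gt0.
have sFP : derMho e G \subset 'Phi(G).
  by rewrite (Phi_joing pG) genS ?setUS // Mho_leq.
apply: leq_trans (dvdn_leq (indexg_gt0 _ _) (indexgS _ sFP)).
rewrite -(part_pnat_id (pnat_dvd (dvdn_indexg _ _) pG)) p_part.
by rewrite leq_exp2l ?prime_gt1 ?grank_le_logn_index_Phi.
Qed.

Theorem corollary3p10 (gT : finGroupType) (G : {group gT}) (p k : nat)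
    (p_pr : prime p) (pG : p.-group G)
    (max_order : (p ^ k)%N =
       \max_(H : {group gT} | [&& H \subset G, nil_class H <= 2
                               & exponent H %| (if p == 2 then 8 else p)])
          #|H|) :
  'm(G) <= k.
Proof.
(* The exponent 4 for p = 2 is the least power of p with p %| 'C(p ^ e, 2), and
   8 is then the least n with p ^ e dividing both n and 'C(n, 2). *)
pose n := if p == 2 then 8 else p; pose e := if p == 2 then 2 else 1%N.
have [pq qn qn2 e_gt0]:
  [/\ p %| 'C(p ^ e, 2), p ^ e %| n, p ^ e %| 'C(n, 2) & 0 < e].
  rewrite /n /e; have [-> //|p_neq2] := eqVneq p 2.
  have p_gt2 : 2 < p by rewrite ltn_neqAle eq_sym p_neq2 prime_gt1.
  by rewrite expn1 prime_dvd_bin ?dvdnn.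
have [H sHG [sFZ leGH]] := exists_derMho_central p_pr pG e_gt0 pq.
have pH := pgroupS sHG pG.
have [K sKH [clK expK leHK]] := exists_large_class2_exponent pH sFZ qn qn2.
rewrite -(leq_exp2l _ _ (prime_gt1 p_pr)) max_order.
apply: leq_trans (expn_grank_le_index_derMho p_pr pG e_gt0) _.
apply: (bigmax_sup K); last exact: leq_trans leGH leHK.
by rewrite (subset_trans sKH sHG) clK.
Qed.
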